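(* Let $G$ be a finite non-abelian $2$-group. Then $G$ is Cayley integral if and only if $G\cong Q_8\times C_2^n$ for some integer $n\geq 0$, where $Q_8$ is the quaternion group of order $8$.
   Context: For a finite group $G$ with identity $1$ and a subset $S\subseteq G\setminus\{1\}$ with $S=S^{-1}$, the undirected Cayley graph $Cay(G,S)$ has vertex set $G$, with vertices $a,b$ adjacent whenever $ab^{-1}\in S$. A graph is integral if all eigenvalues of its adjacency matrix are integers. A finite group $G$ is called Cayley integral if $Cay(G,S)$ is integral for every such subset $S$. $C_2^n$ denotes the direct product of $n$ copies of the cyclic group of order $2$. *)

(* Defs.v *)
From mathcomp Require Import all_boot all_fingroup all_algebra all_solvable all_field.

Set Implicit Arguments.
Unset Strict Implicit.
Unset Printing Implicit Defensive.

Import GroupScope GRing.Theory Num.Theory.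

Definition adjacency_mx (T : finType) (V : {set T}) (e : rel T) : 'M[algC]_#|V| :=
  \matrix_(i, j) ((e (enum_val i) (enum_val j))%:R)%R.

Definition integral_graph (T : finType) (V : {set T}) (e : rel T) : Prop :=
  forall a : algC, eigenvalue (adjacency_mx V e) a -> a \is a Num.int.

Definition cayley_adj (gT : finGroupType) (S : {set gT}) : rel gT :=
  fun a b => a * b^-1 \in S.

(* S^-1 is the elementwise inverse of the set S. *)
Definition cayley_integral (gT : finGroupType) (G : {group gT}) : Prop :=
  forall S : {set gT},
    S \subset G :\ 1 -> S = S^-1 -> integral_graph G (cayley_adj S).

(* The group law of 'Z_2 is addition; the product over 'I_0 is trivial. *)
Definition C2pow (n : nat) := setXn_group (fun _ : 'I_n => Zp_group 2).

(* Main.v *)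
Require Import Defs.
From mathcomp Require Import all_boot all_fingroup all_algebra all_solvable all_field.
From mathcomp Require Import ring zify.

(** If every [x] in [G] satisfies [x ^ 4 = 1] and has [x ^ y] in [{x, x^-1}],
    as in [Q_8 x C_2^n], then the group algebra elements [(s + s^-1) / 2]
    commute pairwise and satisfy [B^3 = B]; an adjacency matrix is a sum of such
    elements, so on a common eigenvector its eigenvalue is a sum of integers.

    Conversely, let [G] be a Cayley integral 2-group and [A] one of its
    adjacency matrices. If [M A^2 = d M] with [M != 0], then [sqrt d] or
    [- sqrt d] is an eigenvalue of [A], so [d] is a square. Suitable [M] with
    [d = 2, 5, 8] show that [G] has exponent 4, that its involutions are central,
    and that non-commuting [x], [y] satisfy [x^2 = y^2 = [x, y]]. Such a pair
    generates a copy [Q] of [Q_8]; every element of [G] can be multiplied by an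
    element of [Q] so as to commute with [x] and [y], and it is then central of
    order at most 2. Hence [G = Q Z(G)] with [Z(G)] elementary abelian, and a
    complement of [Z(Q)] in [Z(G)] is the second factor. *)

Set Implicit Arguments.
Unset Strict Implicit.
Unset Printing Implicit Defensive.

Import GroupScope.

(** * A ring identity for two anticommuting involutions *)

Section RingIdentities.
Import GRing.Theory.
Local Open Scope ring_scope.

(** After multiplication by [M], [X] and [Y] behave as anticommuting involutions and [T] as
    [a X + b Y]; the cross terms of its square cancel. *)
Lemma sq_anticommuting_pair (R : pzRingType) (M T X Y : R) (a b : nat) :
    M * X = X * M -> M * Y = Y * M ->
    M * (X * X) = M -> M * (Y * Y) = M -> M * (X * Y) = - (M * (Y * X)) ->
    M * T = M * X *+ a + M * Y *+ b ->
  M * T * T = M *+ (a ^ 2 + b ^ 2).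
Proof.
move=> MX MY MXX MYY MXY MT.
have XT: M * X * T = M *+ a + M * X * Y *+ b.
  by rewrite MX -mulrA MT mulrDr !mulrnAr !mulrA -MX -!mulrA MXX.
have YT: M * Y * T = M * Y * X *+ a + M *+ b.
  by rewrite MY -mulrA MT mulrDr !mulrnAr !mulrA -MY -!mulrA MYY.
rewrite MT mulrDl !mulrnAl XT YT !mulrnDl -!mulrnA -!mulrA MXY mulNrn.
by rewrite (mulnC b a) addrA addrNK -mulrnDr.
Qed.

End RingIdentities.

(** * Eigenvalues of sums of commuting tripotent matrices *)

Section CommutingTripotents.
Import GRing.Theory Num.Theory.
Local Open Scope ring_scope.

Lemma scale_mulmx (n : nat) (c d : algC) (A B : 'M_n) :
  (c *: A) * (d *: B) = (c * d) *: (A * B).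
Proof. by rewrite -[LHS]scalemxAl -scalemxAr scalerA. Qed.

(** Induction on [s]: [v] is replaced by a nonzero eigenvector of [B i] for 1, -1 or 0. As all the
    matrices commute, it is still an eigenvector of the remaining sum, with this value subtracted
    from [a]. *)
Lemma eigen_sum_tripotent (I : Type) (n : nat) (B : I -> 'M[algC]_n)
    (s : seq I) (v : 'rV_n) (a : algC) :
    (forall i j, B i * B j = B j * B i) ->
    (forall i, B i * B i * B i = B i) ->
    v != 0 -> v *m (\sum_(i <- s) B i) = a *: v ->
  a \is a Num.int.
Proof.
move=> cB B3; elim: s v a => [|i s IHs] v a nzv.
  rewrite big_nil mulmx0 => /esym/eqP.
  by rewrite scaler_eq0 (negPf nzv) orbF => /eqP->.
rewrite big_cons => va.
(* With [b] for [B i], the choices of [Q] and [c] are [b^2 + b] with 1, [b^2 - b] with -1 and, when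
   both of these kill [v] and hence [v b = 0], 1 with 0. *)
suffices split (Q : 'M_n) (c : algC) : (forall j, Q * B j = B j * Q) ->
    v *m Q != 0 -> v *m Q *m B i = c *: (v *m Q) ->
    c \is a Num.int -> a \is a Num.int.
  have cBB j : B i * B i * B j = B j * (B i * B i).
    by rewrite -mulrA (cB i j) mulrA (cB i j) mulrA.
  have [u1_0 | nzu1] := eqVneq (v *m (B i * B i + B i)) 0; last first.
    apply: split nzu1 _ (rpred1 _) => [j|]; first by rewrite mulrDl mulrDr cB cBB.
    by rewrite scale1r -mulmxA -[(_ + _) *m _]/(_ * _) mulrDl B3 addrC.
  have [u2_0 | nzu2] := eqVneq (v *m (B i * B i - B i)) 0; last first.
    apply: split nzu2 _ (rpredN1 _) => [j|].
      by rewrite mulrBl mulrBr cB cBB.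
    rewrite -mulmxA -[(_ - _) *m _]/(_ * _) mulrBl B3.
    by rewrite scaleN1r -[RHS]mulmxN opprB.
  have vB0: v *m B i = 0.
    have: v *m (B i * B i + B i) - v *m (B i * B i - B i) = 0.
      by rewrite u1_0 u2_0 subrr.
    rewrite -mulmxBr opprB [B i - _]addrC addrACA subrr add0r -mulr2n => /eqP.
    by rewrite -scaler_nat -scalemxAr scaler_eq0 pnatr_eq0 => /eqP.
  apply: (split 1 0); rewrite ?rpred0 ?mulmx1 ?vB0 ?scale0r //.
  by move=> j; rewrite mul1r mulr1.
move=> cQ nzw wc /[dup] c_int /(rpredD _) rD.
rewrite -[a](subrK c) rD //; apply: IHs nzw _.
have cQs: Q *m (B i + \sum_(j <- s) B j) = (B i + \sum_(j <- s) B j) *m Q.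
  rewrite mulmxDr mulmxDl [Q *m B i]cQ; congr (_ + _).
  rewrite mulmx_sumr mulmx_suml; apply: eq_bigr => j _; exact: cQ.
have := congr1 (mulmx^~ Q) va; rewrite /= -mulmxA -cQs mulmxA mulmxDr wc.
by rewrite -scalemxAl scalerBl => <-; rewrite addrC addKr.
Qed.

End CommutingTripotents.

(** * The left regular representation and Cayley graph spectra *)

Section LeftRegular.
Import GRing.Theory Num.Theory.
Variables (gT : finGroupType) (G : {group gT}).

(* Left regular representation; it vanishes outside [G]. *)
Definition lregmx (s : gT) : 'M[algC]_#|G| :=
  \matrix_(i, j) ((enum_val i * (enum_val j)^-1 == s)%g%:R)%R.

Lemma lregmx_out s : s \notin G -> lregmx s = 0%R.
Proof.
move=> Gs; apply/matrixP=> i j; rewrite !mxE; case: eqP => // def_s.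
by rewrite -def_s groupM ?groupV ?enum_valP in Gs.
Qed.

Lemma lregmx1 : lregmx 1 = 1%R.
Proof.
apply/matrixP=> i j; rewrite !mxE; congr (nat_of_bool _)%:R%R.
by rewrite -eq_mulgV1 (inj_eq enum_val_inj).
Qed.

Lemma lregmxM s t : s \in G -> lregmx (s * t) = (lregmx s * lregmx t)%R.
Proof.
move=> Gs; apply/matrixP=> i k; rewrite !mxE.
have Gj : s^-1 * enum_val i \in G by rewrite groupM ?groupV ?enum_valP.
(* The only index contributing to the entry of the product: [s = g_i g_j^-1] forces
   [g_j = s^-1 g_i]. *)
pose j := enum_rank_in Gj (s^-1 * enum_val i).
have jE : enum_val j = s^-1 * enum_val i by rewrite enum_rankK_in.
rewrite (bigD1 j) //= big1 => [|j' ne_j'j]; rewrite !mxE.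
  rewrite addr0 jE invMg invgK mulKVg eqxx mul1r -mulgA.
  by rewrite -(inj_eq (mulgI s) _ t) mulKVg.
case: eqP => [def_s|]; last by rewrite mul0r.
case/eqP: ne_j'j; apply: enum_val_inj; rewrite jE.
by rewrite -def_s invMg invgK mulgKV.
Qed.

Lemma cayley_adjacencyE (S : {set gT}) :
  adjacency_mx G (cayley_adj S) = (\sum_(s in S) lregmx s)%R.
Proof.
apply/matrixP=> i j; rewrite summxE mxE /cayley_adj.
set x := _ * _; under eq_bigr do rewrite mxE -/x.
have [Sx | S'x] := boolP (x \in S).
  by rewrite (bigD1 x) //= eqxx big1 ?addr0 // => s /andP[_ /negPf]; rewrite eq_sym => ->.
by rewrite big1 // => s Ss; case: eqP => // xs; rewrite xs Ss in S'x.
Qed.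

(** Conjugation fixes or inverts [s], so [s + s^-1] commutes with every element of [G]; [s^4 = 1]
    makes its half tripotent. *)
Lemma cayley_integral_exp4_dedekind :
    {in G, forall x, x ^+ 4 = 1} ->
    {in G &, forall x y, x ^ y = x \/ x ^ y = x^-1} ->
  cayley_integral G.
Proof.
move=> G4 conjG S sSG SV a /eigenvalueP[v va nzv].
pose B s : 'M[algC]_#|G| := (2%:R^-1 *: (lregmx s + lregmx s^-1))%R.
(* Since [S = S^-1], the terms [s^-1] have the same sum as the terms [s]; the factor 1/2
   compensates. *)
have adjE : adjacency_mx G (cayley_adj S) = (\sum_(s <- enum S) B s)%R.
  rewrite big_enum -scaler_sumr big_split /= cayley_adjacencyE.
  rewrite [X in (_ + X)%R](_ : _ = \sum_(s in S) lregmx s)%R.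
    by rewrite -mulr2n -scaler_nat scalerA mulVf ?pnatr_eq0 ?scale1r.
  rewrite (reindex_inj invg_inj) /=; apply: eq_big => [s|s _]; last by rewrite invgK.
  by rewrite {2}SV inE.
rewrite adjE in va; apply: eigen_sum_tripotent nzv va => [s t | s].
  (* The indices range over the whole type, so elements outside [G] are covered by [B] being zero
     there. *)
  have out u : u \notin G -> B u = 0%R.
    by move=> Gu; rewrite /B !lregmx_out ?groupV ?addr0 ?scaler0.
  have [Gs | /out->] := boolP (s \in G); last by rewrite mulr0 mul0r.
  have [Gt | /out->] := boolP (t \in G); last by rewrite mulr0 mul0r.
  have cst u : u \in G ->
      ((lregmx s + lregmx s^-1) * lregmx u = lregmx u * (lregmx s + lregmx s^-1))%R.
    move=> Gu; rewrite mulrDr mulrDl -!lregmxM ?groupV //.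
    rewrite (conjgC s) (conjgC s^-1) conjVg.
    by case: (conjG s u Gs Gu) => ->; rewrite ?invgK // addrC.
  rewrite /B !scale_mulmx; congr (_ *: _)%R.
  by rewrite [LHS]mulrDr [RHS]mulrDl !cst ?groupV.
have [Gs | Gs] := boolP (s \in G); last first.
  by rewrite /B !lregmx_out ?groupV ?addr0 ?scaler0 ?mulr0.
have s3 : s * s * s = s^-1.
  by apply: (mulgI s); rewrite mulgV -(G4 s Gs) !expgS mulg1 !mulgA.
have sV2 : s^-1 * s^-1 = s * s by rewrite -{1}s3 -!mulgA mulgV mulg1.
rewrite /B !scale_mulmx.
(* [s^-2 = s^2] turns the square into [2 (s^2 + 1)]; a further factor [s + s^-1] then gives
   [4 (s + s^-1)]. *)
have -> : ((lregmx s + lregmx s^-1) * (lregmx s + lregmx s^-1) =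
           (lregmx (s * s) + 1) *+ 2)%R.
  rewrite mulrDl !mulrDr -!lregmxM ?groupV // sV2 mulgV mulVg lregmx1.
  by rewrite mulr2n [(1 + _)%R]addrC.
rewrite mulrnAl mulrDl mul1r mulrDr -!lregmxM ?groupM // s3 mulgK.
rewrite (addrC (lregmx s^-1)) -mulr2n -mulrnA -scaler_nat scalerA.
by congr (_ *: _)%R; field.
Qed.

(** A nonzero row [v] of [M] has [v A^2 = d v]. With [r = sqrt d], the vector [v A + r v] is an
    eigenvector for [r] unless it is zero, and then [v] is one for [-r]. *)
Lemma cayley_integral_square (S : {set gT}) (M : 'M[algC]_#|G|) (d : nat) :
    cayley_integral G -> S \subset G :\ 1 -> S = S^-1 -> M != 0%R ->
    (M * (\sum_(s in S) lregmx s) * (\sum_(s in S) lregmx s) = M *+ d)%R ->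
  exists k : nat, d = (k ^ 2)%N.
Proof.
move=> Gint sSG SV nzM; rewrite -cayley_adjacencyE.
have intA := Gint S sSG SV; set A := adjacency_mx G _ in intA * => MAA.
have [i nzv] : exists i, row i M != 0%R.
  apply/existsP; apply: contraR nzM; rewrite negb_exists => /forallP-M0.
  by apply/eqP/row_matrixP=> i; rewrite row0; apply/eqP; rewrite -[_ == _]negbK M0.
set v := row i M in nzv; pose r : algC := sqrtC d%:R.
have rr : (r * r = d%:R)%R by rewrite -expr2 sqrtCK.
have vAA : (v *m A *m A = d%:R *: v)%R.
  by rewrite -!row_mul [(M *m A *m A)%R]MAA -scaler_nat linearZ.
have [c cc c_int] : exists2 c : algC, (c * c = d%:R)%R & c \is a Num.int.
  have [vAr | nz] := eqVneq (v *m A + r *: v)%R 0%R.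
    exists (- r)%R; first by rewrite mulrNN.
    apply: intA; apply/eigenvalueP; exists v => //.
    by apply/eqP; rewrite scaleNr -addr_eq0 vAr.
  exists r => //; apply: intA; apply/eigenvalueP; exists (v *m A + r *: v)%R => //.
  by rewrite mulmxDl vAA -scalemxAl scalerDr scalerA rr addrC.
have /natrP[k def_k] : (`|c|)%R \is a Num.nat by rewrite natr_norm_int.
exists k; apply/eqP; rewrite -(eqr_nat algC) natrX -def_k -cc.
by rewrite intr_normK // expr2.
Qed.

End LeftRegular.

(** * Constraints on powers and commutators in a Cayley integral group *)

Section IntegralGroup.
Import GRing.Theory Num.Theory.
Variables (gT : finGroupType) (G : {group gT}).
Local Notation lregmx := (lregmx G).

(** If [x^4] were not 1, take [S = {x, x^-1}] and [M = 1 - x^4]. Then [M x^4 = -M], so [x^2] and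
    [x^-2] cancel in [A^2 = x^2 + x^-2 + 2], leaving [d = 2]. *)
Lemma cayley_integral_expg8 x :
  cayley_integral G -> x \in G -> x ^+ 8 = 1 -> x ^+ 4 = 1.
Proof.
move=> Gint Gx x8; apply/eqP/idPn=> ntx4.
have x2 : x * x != 1.
  by apply: contraNneq ntx4 => x2;
    rewrite -[4]/(2 * 2)%N expgM [x ^+ 2]expgS expg1 x2 expg1n.
have xVx : x^-1 * x^-1 = x * x * x ^+ 4.
  rewrite -invMg; apply: (mulgI (x * x)); rewrite mulgV -x8 mulgA.
  by rewrite (expgD x 4 4) !expgS expg0 mulg1 !mulgA.
pose M : 'M[algC]_#|G| := (1 - lregmx (x ^+ 4))%R.
suffices: exists k, 2 = (k ^ 2)%N by case=> [[|[|k]]] //; rewrite !expnS; lia.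
apply: (cayley_integral_square (S := [set x; x^-1]) (M := M)) => //.
- rewrite subUset !sub1set !inE groupV Gx invg_eq1 andbT andbb.
  by apply: contraNneq x2 => ->; rewrite mulg1.
- by apply/setP=> y; rewrite !inE !eq_invg_sym invgK orbC.
- apply/eqP=> M0; pose i := enum_rank_in (group1 G) 1.
  have /eqP := congr1 (fun A : 'M_#|G| => A i i) M0.
  rewrite /= /M -(lregmx1 G) !mxE !mulgV eqxx [_ == x ^+ 4]eq_sym (negPf ntx4).
  by rewrite subr0 oner_eq0.
have Gx4 : x ^+ 4 \in G by rewrite groupX.
have x44 : x ^+ 4 * x ^+ 4 = 1 by rewrite -expgD.
have x4x : x * x * x ^+ 4 = x ^+ 4 * (x * x) by rewrite -[x * x]/(x ^+ 2) -!expgD.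
rewrite big_setU1 /= ?big_set1 ?inE; last by rewrite eq_sym eq_invg_mul.
have TT : ((lregmx x + lregmx x^-1) * (lregmx x + lregmx x^-1) =
           lregmx (x * x) + lregmx (x * x * x ^+ 4) + 1 *+ 2)%R.
  rewrite mulrDl !mulrDr -!lregmxM ?groupV // xVx mulgV mulVg lregmx1.
  by rewrite [(1 + _)%R]addrC addrACA -mulr2n.
rewrite -mulrA TT mulrDr mulrnAr mulr1 -[RHS]add0r; congr (_ + _)%R.
rewrite /M mulrBl mul1r mulrDr -!lregmxM // x4x (mulgA (x ^+ 4) (x ^+ 4)) x44 mul1g.
by rewrite [X in (_ - X)%R]addrC subrr.
Qed.

(** If [c] were outside the list, [S = {x, x^-1, y, y^-1}] would give [d = a^2 + b^2], where [a] and
    [b], each 1 or 2, are the sizes of [{x, x^-1}] and [{y, y^-1}]. None of 2, 5, 8 is a square. *)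
Lemma cayley_integral_commutator x y (z := x * x) (w := y * y) (c := [~ x, y]) :
    cayley_integral G -> x \in G -> y \in G ->
    z * z = 1 -> w * w = 1 -> commute z y -> commute w x ->
    commute c x -> commute c y ->
  c \in [:: 1; z; w; z * w].
Proof.
move=> Gint Gx Gy zz ww zy wx cx cy; apply/idPn; rewrite !inE !negb_or.
case/and4P=> ntc cz cw czw.
have xy : x * y = y * x * c by rewrite -commgC.
have Gc : c \in G by rewrite groupR.
have Gz : z \in G by rewrite groupM.
have Gw : w \in G by rewrite groupM.
(* Moving [y] leftwards past both factors of [x * x] produces [c^2], yet [z] commutes with [y]. *)
have cc : c * c = 1.
  apply: (mulgI (y * z)); rewrite mulg1 -[RHS]zy -[RHS]mulgA.
  by rewrite xy (mulgA x) (mulgA x y) xy -(mulgA _ c x) cx !mulgA.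
have xz : commute x z by rewrite /z; apply: commuteM.
have yw : commute y w by rewrite /w; apply: commuteM.
have cz' : commute c z by apply: commuteM.
have cw' : commute c w by apply: commuteM.
have zw : commute z w by apply: commuteM.
have lregC s t : s \in G -> t \in G -> commute s t -> GRing.comm (lregmx s) (lregmx t).
  by move=> Gs Gt st; rewrite /GRing.comm -!lregmxM // st.
set X := lregmx x; set Y := lregmx y.
set Z := lregmx z; set W := lregmx w; set C := lregmx c.
(* [M] cuts out the part of the regular representation where [z = w = 1] and
   [c = -1]; there [x] and [y] act as anticommuting involutions. *)
pose M : 'M[algC]_#|G| := ((1 + Z) * (1 + W) * (1 - C))%R.
have commM u : u \in G -> commute u z -> commute u w -> commute u c ->
    (M * lregmx u = lregmx u * M)%R.
  move=> Gu uz uw uc; apply/esym/commrM; first apply/commrM.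
  - by apply/commrD; [apply: commr1 | apply: lregC].
  - by apply/commrD; [apply: commr1 | apply: lregC].
  by apply/commrD; [apply: commr1 | apply/commrN/lregC].
have MX : (M * X = X * M)%R by apply: commM.
have MY : (M * Y = Y * M)%R by apply: commM.
have mul1D u : u \in G -> u * u = 1 ->
    (lregmx u * (1 + lregmx u) = 1 + lregmx u)%R.
  by move=> Gu uu; rewrite mulrDr mulr1 -lregmxM // uu lregmx1 addrC.
have MZ : (M * Z = M)%R by rewrite commM // /M !mulrA mul1D.
have MW : (M * W = M)%R.
  have W1Z : (W * (1 + Z) = (1 + Z) * W)%R.
    by rewrite mulrDr mulrDl mulr1 mul1r -!lregmxM // zw.
  by rewrite commM // /M !mulrA W1Z -(mulrA _ W) mul1D.
have MC : (M * C = - M)%R.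
  by rewrite /M -mulrA mulrBl mul1r -lregmxM // cc lregmx1 -mulrN opprB.
have xV : x^-1 = z * x by apply/eqP; rewrite eq_invg_mul mulgA xz -mulgA; apply/eqP.
have yV : y^-1 = w * y by apply/eqP; rewrite eq_invg_mul mulgA yw -mulgA; apply/eqP.
pose S := [set x; x^-1] :|: [set y; y^-1].
have nxy : y \notin [set x; x^-1].
  apply: contra ntc; rewrite !inE /c => /orP-yx; apply/commgP.
  by case: yx => /eqP-> //; apply: commuteV.
suffices [k def_k] : exists k, #|[set x; x^-1]| ^ 2 + #|[set y; y^-1]| ^ 2 = (k ^ 2)%N.
  (* The sum is at most 8, so [k < 3], and the squares 0, 1, 4 are excluded. *)
  rewrite !cards2 in def_k.
  have: k ^ 2 < 3 ^ 2 by rewrite -def_k; do 2!case: (_ != _).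
  by rewrite ltn_sqr; case: k def_k => [|[|[|]]] //; do 2!case: (_ != _).
apply: (cayley_integral_square (S := S) (M := M)) => //.
- rewrite !subUset !sub1set !inE !groupV Gx Gy !invg_eq1 !andbT !andbb.
  apply/andP; split; rewrite /c; apply: contraNneq ntc => e1;
    apply/commgP; rewrite e1; [exact/commute_sym/commute1 | exact/commute1].
- apply/setP=> t; rewrite !inE !eqg_invLR !invgK.
  by congr (_ || _); exact: orbC.
(* The diagonal entry of [M] at 1 is positive: the terms with factor [c] contribute nothing, as [c]
   avoids [1], [z], [w] and [z w]. *)
- apply/eqP=> M0; pose i := enum_rank_in (group1 G) 1.
  have /eqP := congr1 (fun A : 'M_#|G| => A i i) M0.
  rewrite /= /M mulrBr mulr1 !mulrDl !mulrDr !mul1r !mulr1 !mulrDl !mul1r.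
  rewrite -!lregmxM ?groupM // -(lregmx1 G) !mxE !mulgV.
  have cV : c^-1 = c by apply/eqP; rewrite eq_invg_mul cc.
  have c_eq u : (1 == u * c) = (c == u) by rewrite eq_sym mulg_eq1 cV eq_sym.
  rewrite !c_eq [1 == c]eq_sym (negPf ntc) (negPf cz) (negPf cw) (negPf czw).
  by rewrite !addr0 subr0 eqxx -!natrD pnatr_eq0.
apply: sq_anticommuting_pair MX MY _ _ _ _.
- by rewrite -lregmxM.
- by rewrite -lregmxM.
- have cyx : commute c (y * x) by apply: commuteM.
  by rewrite -!lregmxM // xy -cyx (lregmxM _ Gc) mulrA MC mulNr.
(* As [x^-1 = z x] and [M Z = M], both [x] and [x^-1] contribute [M X], hence the multiplicity;
   likewise for [y]. *)
have Msum t t' : (M * lregmx t' = M * lregmx t)%R ->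
    (M * (\sum_(s in [set t; t']) lregmx s) = M * lregmx t *+ #|[set t; t']|)%R.
  move=> MtV; rewrite mulr_sumr -sumr_const; apply: eq_bigr => s.
  by rewrite !inE => /orP[]/eqP->.
have MXV : (M * lregmx (x^-1)%g = M * X)%R by rewrite xV lregmxM // mulrA MZ.
have MYV : (M * lregmx (y^-1)%g = M * Y)%R by rewrite yV lregmxM // mulrA MW.
rewrite -!Msum // -mulrDr; congr (_ * _)%R; rewrite -bigU /=.
  by apply: eq_bigl => s; rewrite !inE.
rewrite disjoint_sym disjoints_subset subUset !sub1set !inE.
by move: nxy; rewrite !inE eqg_inv eqg_invLR [X in _ && ~~ X]orbC => ->.
Qed.

(** An exponent [2^(k+3)] drops to [2^(k+2)] by the result on eighth powers applied to [x^(2^k)]. *)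
Lemma cayley_integral_exp4 :
  cayley_integral G -> 2.-group G -> {in G, forall x, x ^+ 4 = 1}.
Proof.
move=> Gint G2 x Gx; have /p_natP[k ox] := mem_p_elt G2 Gx.
have : x ^+ (2 ^ k) = 1 by rewrite -ox expg_order.
elim: k {ox} => [|[|[|k]] IHk] //; do ?[by rewrite expg1 => ->; rewrite ?expg1n].
  by move=> x2; rewrite -[4]/(2 * 2)%N expgM x2 expg1n.
rewrite -[k.+3]addn3 expnD expgM => x8; apply: IHk.
by rewrite -[k.+2]addn2 expnD expgM; apply: cayley_integral_expg8 => //; apply: groupX.
Qed.

(** Here [[x, y] = (x y)^2] is its own inverse, hence equal to [(y x)^2], and so commutes with [x]
    and [y]; for involutions the list of possible commutators reduces to 1. *)
Lemma cayley_integral_involutions_commute :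
    cayley_integral G -> {in G, forall x, x ^+ 4 = 1} ->
  {in G &, forall x y, x * x = 1 -> y * y = 1 -> commute x y}.
Proof.
move=> Gint G4 x y Gx Gy xx yy.
have xV : x^-1 = x by apply/eqP; rewrite eq_invg_mul xx.
have yV : y^-1 = y by apply/eqP; rewrite eq_invg_mul yy.
have cE : [~ x, y] = x * y * (x * y) by rewrite commgEl conjgE xV yV !mulgA.
have xyV : (x * y)^-1 = y * x by rewrite invMg xV yV.
have c2 : x * y * (x * y) = y * x * (y * x).
  apply/eqP; rewrite -xyV -invMg -mulg_eq1 -(G4 _ (groupM Gx Gy)).
  by rewrite !expgS mulg1 !mulgA.
have := @cayley_integral_commutator x y Gint Gx Gy.
rewrite xx yy !mulg1 !inE !orbb => /(_ erefl erefl) c1.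
apply/commgP/c1; rewrite ?cE /commute; try exact/commute_sym/commute1.
- by rewrite {1}c2 -!mulgA xx mulg1 (mulgA x x) xx mul1g.
- by rewrite {2}c2 -!mulgA yy mulg1 (mulgA y y) yy mul1g.
Qed.

Lemma cayley_integral_involution_central :
    cayley_integral G -> {in G, forall x, x ^+ 4 = 1} ->
  {in G &, forall x y, y * y = 1 -> commute x y}.
Proof.
move=> Gint G4 x y Gx Gy yy; set z := x * x.
have involutions_commute := cayley_integral_involutions_commute Gint G4.
have yV : y^-1 = y by apply/eqP; rewrite eq_invg_mul yy.
have zz : z * z = 1 by rewrite -(G4 x Gx) !expgS mulg1 !mulgA.
have zy : commute z y by apply: involutions_commute; rewrite ?groupM.
have cE : [~ x, y] = y ^ x * y by rewrite commgEr yV.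
have xyC : x * y = y * x * [~ x, y] by rewrite -commgC.
have yxy : commute (y ^ x) y.
  by apply: involutions_commute; rewrite ?groupJ // -conjMg yy conj1g.
have cx : commute [~ x, y] x.
  rewrite cE /commute conjgC conjMg -conjgM -/z.
  by rewrite [y ^ z]conjgE -zy mulKg yxy.
have cy : commute [~ x, y] y by rewrite cE; apply: commute_sym; apply: commuteM.
have := @cayley_integral_commutator x y Gint Gx Gy zz.
rewrite yy mulg1 => /(_ erefl zy (commute_sym (commute1 _)) cx cy).
rewrite !mulg1 !inE => /or4P c1z.
have {c1z} [/commgP // | cz] : [~ x, y] == 1 \/ [~ x, y] = z.
  by case: c1z => [] /eqP->; auto.
(* If [[x, y] = x^2], then [x y] squares to 1, so it commutes with [y], and therefore so does
   [x]. *)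
have xyxy : x * y * (x * y) = 1.
  have -> : x * y * (x * y) = y * (z * z) * y by rewrite {1}xyC cz !mulgA.
  by rewrite zz mulg1 yy.
have := involutions_commute _ _ (groupM Gx Gy) Gy xyxy yy.
rewrite /commute -!mulgA yy mulg1 => xE.
by rewrite {1}xE -!mulgA yy mulg1.
Qed.

Lemma cayley_integral_noncommuting :
    cayley_integral G -> {in G, forall x, x ^+ 4 = 1} ->
  {in G &, forall x y, x * y != y * x ->
    x * x = [~ x, y] /\ y * y = [~ x, y]}.
Proof.
move=> Gint G4 x y.
have involution_central := cayley_integral_involution_central Gint G4.
have sqK u : u \in G -> u * u * (u * u) = 1.
  by move=> Gu; rewrite -(G4 u Gu) !expgS mulg1 !mulgA.
have sqC u v : u \in G -> v \in G -> commute (u * u) v.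
  by move=> Gu Gv; apply/commute_sym/involution_central; rewrite ?groupM ?sqK.
(* A commutator is a product of squares, and squares, having square 1, are central. *)
have cE (u v : gT) : [~ u, v] = (u * u)^-1 * (u * v^-1 * (u * v^-1)) * (v * v).
  by rewrite invMg commgEl conjgE -!mulgA !mulKg.
have cC u v t : u \in G -> v \in G -> t \in G -> commute [~ u, v] t.
  move=> Gu Gv Gt; rewrite cE; apply/commute_sym/commuteM; first apply/commuteM.
  - by apply/commuteV/commute_sym/sqC.
  - by apply/commute_sym/sqC; rewrite ?groupM ?groupV.
  exact/commute_sym/sqC.
have comm u v : u \in G -> v \in G ->
    [~ u, v] \in [:: 1; u * u; v * v; u * u * (v * v)].
  move=> Gu Gv; apply: cayley_integral_commutator => //;
    solve [exact: sqK | exact: sqC | exact: cC].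
move=> Gx Gy nxy; have [c Dc] : {c | c = [~ x, y]} by exists [~ x, y].
have Gxy := groupM Gx Gy.
have xyC : x * y = y * x * c by rewrite Dc -commgC.
have ntsq u : u \in G -> x * u != u * x \/ u * y != y * u -> u * u == 1 = false.
  move=> Gu nuxy; apply/eqP=> uu.
  have uC v (Gv : v \in G) : commute v u by apply: involution_central.
  by case: nuxy => /eqP[]; [apply: uC | apply/esym/uC].
have cz : commute c (x * x) by rewrite Dc; apply: cC; rewrite ?groupM.
have cw : commute c (y * y) by rewrite Dc; apply: cC; rewrite ?groupM.
have xyxy : x * y * (x * y) = x * x * (y * y) * c.
  rewrite {1}xyC -(mulgA _ c) Dc cC // -Dc 2!mulgA -(mulgA y x x).
  by rewrite -(sqC x y) // !mulgA.
(* The pairs [(x, y)], [(x, x y)] and [(x y, y)] share the commutator [c], and [(x y)^2 = z w c].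
   The three lists together leave only [c = z = w]. *)
have := comm x y Gx Gy.
have := comm x (x * y) Gx Gxy.
have := comm (x * y) y Gxy Gy.
rewrite commgMJ commMgJ !commgg conj1g !mulg1.
rewrite (_ : [~ x, y] ^ y = c) -?Dc; last by rewrite conjgE {1}Dc cC // mulKg.
rewrite xyxy; move: (ntsq x Gx) (ntsq y Gy) (sqK x Gx) (sqK y Gy) cz cw.
have /(sqC x _ Gx) : y * y \in G by rewrite groupM.
move: (x * x) (y * y) => z w zw ntz ntw zz ww cz cw.
have ntc : c == 1 = false.
  by apply: contraNF nxy => /eqP c1; rewrite xyC c1 mulg1.
have mulc1 t : (c == t * c) = (t == 1) by rewrite eq_sym -{2}(mul1g c) (inj_eq (mulIg c)).
have zwc : (c == z * w * c) = (z == w).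
  by rewrite mulc1 mulg_eq1 (_ : w^-1 = w) //; apply/eqP; rewrite eq_invg_mul ww.
have -> : z * w * c * w = z * c by rewrite -mulgA cw -!mulgA (mulgA w w) ww mul1g.
have -> : z * (z * w * c) = w * c by rewrite !mulgA zz mul1g.
rewrite !inE ntc zwc !mulc1 ntz; last by right.
rewrite ntw; last by left.
rewrite !orbF /= => /orP[/eqP zw1 _ | /eqP cw1 /orP[/eqP cz1 | /eqP zw1]] //;
  last by rewrite zw1 -cw1.
by rewrite -zw1 zz ntc orbF orbb => /eqP.
Qed.

End IntegralGroup.

(** * Recognising [Q_8] and splitting off an elementary abelian factor *)

(** The relations make [H] an image of ['Q_8]. Conversely, [H] is a 2-group properly containing
    [<[x]>] of order 4, so it has at least 8 elements. *)
Lemma quaternion_group_recognition (gT : finGroupType) (Q : {group gT}) (x y : gT) :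
    2.-group Q -> x \in Q -> y \in Q -> x ^+ 4 = 1 -> x * y != y * x ->
    y * y = x * x -> [~ x, y] = x * x ->
  <<[set x; y]>> \isog 'Q_8.
Proof.
move=> Q2 Qx Qy x4 nxy yy cxy; set H := <<_>>.
have sHQ : H \subset Q by rewrite gen_subG subUset !sub1set Qx.
have Hx : x \in H by rewrite mem_gen ?set21.
have Hy : y \in H by rewrite mem_gen ?set22.
have ox : #[x] = 4.
  have: #[x] %| 2 ^ 2 by rewrite order_dvdn x4.
  case/(dvdn_pfactor _ _ (isT : prime 2)) => [[|[|[|]]]] // _ ox.
    by case/eqP: nxy; move/eqP: ox; rewrite order_eq1 => /eqP->; rewrite mul1g mulg1.
  case/eqP: nxy; apply/commgP; rewrite cxy.
  by have := expg_order x; rewrite ox => /eqP.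
rewrite isogEcard (card_quaternion (isT : 2 < 3)) (Grp_quaternion (isT : 2 < 3)).
apply/andP; split.
  apply/existsP; exists (x, y); rewrite /= !xpair_eqE.
  apply/and4P; split; first by rewrite joing_idl joing_idr.
  - by rewrite x4.
  - exact/eqP.
  by rewrite conjg_mulR cxy eq_sym eq_invg_mul -x4 !expgS mulg1.
have sXH : <[x]> \proper H.
  rewrite properE cycle_subG Hx; apply: contra nxy => sHX.
  have /cycleP[i ->] := subsetP sHX y Hy.
  by rewrite -expgS -expgSr.
have /p_natP[k oH] : 2.-nat #|H| by apply: (pgroupS sHQ Q2).
have := proper_card sXH; rewrite -[#|<[x]>|]/#[x] ox oH -[4]/(2 ^ 2)%N ltn_exp2l //.
by move=> k2; rewrite leq_exp2l.
Qed.

Lemma C2pow_abelem n : 2.-abelem (C2pow n).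
Proof.
rewrite abelemE //; apply/andP; split.
  apply/centsP=> f _ g _; apply/ffunP=> i; rewrite !ffunE; exact: Zp_mulgC.
apply/exponentP=> f _; apply/ffunP=> i; rewrite expgS expg1 !ffunE.
by case: (f i) => [[|[|]]] //= ?; apply: val_inj.
Qed.

Lemma card_C2pow n : #|C2pow n| = (2 ^ n)%N.
Proof.
rewrite cardsXn -[in RHS](card_ord n) -prod_nat_const; apply: eq_bigr => i _.
by rewrite card_Zp.
Qed.

Lemma isog_quaternion_prod_C2pow (gT : finGroupType) (G : {group gT}) :
    2.-group G -> ~~ abelian G ->
    {in G, forall x, x ^+ 4 = 1} ->
    {in G &, forall x y, y * y = 1 -> commute x y} ->
    {in G &, forall x y, x * y != y * x -> x * x = [~ x, y] /\ y * y = [~ x, y]} ->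
  exists n, G \isog setX 'Q_8 (C2pow n).
Proof.
move=> G2 nabG G4 invC ncG.
have [x [y [Gx Gy nxy]]] : exists x, exists y, [/\ x \in G, y \in G & x * y != y * x].
  case/subsetPn: nabG => x Gx; rewrite -sub_cent1 => /subsetPn[y Gy].
  by rewrite cent1C => /cent1P/eqP; exists x, y; split.
have [xx yy] := ncG x y Gx Gy nxy.
have sqK u : u \in G -> u * u * (u * u) = 1.
  by move=> Gu; rewrite -(G4 u Gu) !expgS mulg1 !mulgA.
have sqC u v : u \in G -> v \in G -> commute (u * u) v.
  by move=> Gu Gv; apply/commute_sym/invC; rewrite ?groupM ?sqK.
pose Q := <<[set x; y]>>%G.
have isoQ : Q \isog 'Q_8.
  by apply: (quaternion_group_recognition G2) => //; rewrite ?G4 // ?yy -?xx.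
have sQG : Q \subset G by rewrite gen_subG subUset !sub1set Gx.
have Qx : x \in Q by rewrite mem_gen ?set21.
have Qy : y \in Q by rewrite mem_gen ?set22.
(* If neither [h] nor [a] commutes with [b], both commutators with [b] equal the central [b^2], so
   [[h a, b] = b^4 = 1]. *)
have step a b h : a \in G -> b \in G -> h \in G -> a * b != b * a ->
    exists2 q, q = 1 \/ q = a & commute (h * q) b.
  move=> Ga Gb Gh nab; have [hb | nhb] := eqVneq (h * b) (b * h).
    by exists 1; [left | rewrite mulg1].
  exists a; first by right.
  apply/commgP; rewrite commMgJ -(ncG h b Gh Gb nhb).2 -(ncG a b Ga Gb nab).2.
  by rewrite conjgE sqC // mulKg sqK.
(* [h x] does not commute with [y], so [h^2 x^2 = (h x)^2 = y^2 = x^2]. *)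
have sq_cent h : h \in G -> commute h x -> commute h y -> h * h = 1.
  move=> Gh hx hy; have nhxy : h * x * y != y * (h * x).
    apply: contraNneq nxy => e; apply/eqP/(mulgI h).
    by rewrite (mulgA h x) e (mulgA h y) hy mulgA.
  have [hxhx hxy] := ncG (h * x) y (groupM Gh Gx) Gy nhxy.
  apply: (mulIg (x * x)); rewrite mul1g [RHS]xx -yy hxy -hxhx.
  by rewrite !mulgA -(mulgA h x) -hx !mulgA.
have defG : Q * 'Z(G) = G.
  apply/eqP; rewrite eqEsubset mul_subG ?center_sub //=.
  apply/subsetP=> g Gg.
  have [q1 Dq1 c1] := step x y g Gx Gy Gg nxy.
  have Qq1 : q1 \in Q by case: Dq1 => ->.
  have Gh1 : g * q1 \in G by rewrite groupM ?(subsetP sQG q1).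
  have [|q2 Dq2 c2] := step y x (g * q1) Gy Gx Gh1; first by rewrite eq_sym.
  have Qq2 : q2 \in Q by case: Dq2 => ->.
  (* The second correction [q2] is 1 or [y], so it preserves commutation with [y]. *)
  have c3 : commute (g * q1 * q2) y.
    by case: Dq2 => ->; rewrite ?mulg1 //; apply/commute_sym/commuteM.
  have Gh : g * q1 * q2 \in G by rewrite groupM ?(subsetP sQG q2).
  have [h Dh] : {h | h = g * q1 * q2} by exists (g * q1 * q2).
  rewrite -Dh in c2 c3 Gh; have hh := sq_cent h Gh c2 c3.
  have Gq : (q1 * q2)^-1 \in G by rewrite groupV (subsetP sQG) ?groupM.
  have -> : g = (q1 * q2)^-1 * h.
    have -> : (q1 * q2)^-1 * h = h * (q1 * q2)^-1 by apply: invC.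
    by rewrite Dh invMg -!mulgA mulKVg mulgV mulg1.
  rewrite mem_mulg ?groupV ?groupM //; apply/centerP; split=> // u Gu.
  exact/commute_sym/invC.
have abZ : 2.-abelem 'Z(G).
  rewrite abelemE // center_abelian; apply/exponentP=> h /centerP[Gh Ch].
  by apply: sq_cent => //; apply: Ch.
have Zxx : x * x \in 'Z(G).
  by apply/centerP; split; [rewrite groupM | move=> u; apply: sqC].
have sXZ : <[x * x]> \subset 'Z(G) by rewrite cycle_subG.
have [F defZ] := abelem_split_dprod abZ sXZ.
have [_ defXF cXF tiXF] := dprodP defZ.
have sFZ : F \subset 'Z(G) by rewrite -defXF mulG_subr.
have Qxx : <[x * x]> \subset Q by rewrite cycle_subG groupM.
(* This gives the trivial intersection: [F] is central, so [Q] meets it inside ['Z(Q)], that is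
   [<[x * x]>], to which [F] is a complement. *)
have defZQ : 'Z(Q) = <[x * x]>.
  have [[u v] genQ _] := generators_quaternion (isT : 2 < 3) isoQ.
  have [_ _ [_ oZ _ _ _] _ _] := quaternion_structure (isT : 2 < 3) genQ isoQ.
  apply/eqP; rewrite eq_sym eqEcard oZ subsetI Qxx /=.
  rewrite (subset_trans sXZ) ?(subset_trans (subsetIr _ _)) ?centS //=.
  rewrite -[#|_|]/#[x * x] order_gt1; apply: contraNneq nxy => xx1.
  by apply/eqP/commute_sym/invC.
have defQF : Q \x F = G.
  rewrite dprodE.
  - by rewrite -defG -defXF mulgA (mulGSid Qxx).
  - by rewrite (subset_trans sFZ) ?(subset_trans (subsetIr _ _)) ?centS.
  apply/trivgP; rewrite -tiXF subsetI subsetIr andbT /= -defZQ subsetI subsetIl /=.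
  by rewrite subIset // (subset_trans sFZ) ?orbT // (subset_trans (subsetIr _ _)) ?centS.
have abF : 2.-abelem F := abelemS sFZ abZ.
have /p_natP[n oF] : 2.-nat #|F| by case/and3P: abF.
exists n; apply: (isog_dprod defQF (setX_dprod _ _)).
  by apply: isog_trans isoQ (isog_setX1 _ _).
apply: isog_trans (isog_set1X _ _).
by rewrite (isog_abelem_card _ abF) C2pow_abelem card_C2pow oF eqxx.
Qed.

(** * Exponent and conjugation in [Q_8] and its products with [C_2^n] *)

(** Elements of order at most 2 are central. A cyclic subgroup of order 4 has index 2, hence is
    normal, and its only generators are [u] and [u^3 = u^-1]. *)
Lemma quaternion_exp4_dedekind (gT : finGroupType) (Q : {group gT}) :
    Q \isog 'Q_8 ->
  {in Q, forall u, u ^+ 4 = 1} /\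
  {in Q &, forall u v, u ^ v = u \/ u ^ v = u^-1}.
Proof.
move=> isoQ; have oQ : #|Q| = 8.
  by rewrite (card_isog isoQ) (card_quaternion (isT : 2 < 3)).
have [[x y] genQ _] := generators_quaternion (isT : 2 < 3) isoQ.
have [_ _ ox _] := genQ.
have [[_ oX' _] _ [defZ _ ZP _ _] _ _] :=
  quaternion_structure (isT : 2 < 3) genQ isoQ.
have exp4 : {in Q, forall u, u ^+ 4 = 1}.
  move=> u Qu; apply/eqP; rewrite -order_dvdn.
  have [Xu | X'u] := boolP (u \in <[x]>); first by rewrite -[4]ox order_dvdG.
  by rewrite oX' // inE X'u.
split=> // u v Qu Qv.
have: #[u] %| 2 ^ 2 by rewrite order_dvdn exp4.
case/(dvdn_pfactor _ _ (isT : prime 2)) => [[|[|[|]]]] // _ ou.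
- by left; move/eqP: ou; rewrite order_eq1 => /eqP->; rewrite conj1g.
- have: u \in 'Z(Q) by rewrite defZ (ZP u) // cycle_id.
  by case/centerP=> _ cu; left; rewrite conjgE cu // mulKg.
have sUQ : <[u]> \subset Q by rewrite cycle_subG.
have nU : v \in 'N(<[u]>).
  apply: (subsetP (normal_norm (index2_normal sUQ _))) => //.
  by rewrite -divgS //= oQ -[#|<[u]>|]/#[u] ou.
have : u ^ v \in <[u]> by rewrite memJ_norm // cycle_id.
case/cyclePmin=> i; rewrite ou => lti4 uv.
have: #[u ^ v] = #[u] by rewrite orderJ.
rewrite uv; case: i lti4 uv => [|[|[|[|]]]] // _ _.
- by rewrite order1 ou.
- by left.
- by rewrite orderXdiv ou.
by move=> _; right; apply: (mulgI u); rewrite -expgS mulgV exp4.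
Qed.

(** The second component is fixed by conjugation and is its own inverse, so either alternative for
    the first component extends to the pair. *)
Lemma quaternion_prod_exp4_dedekind (gT : finGroupType) (G : {group gT}) (n : nat) :
    G \isog setX 'Q_8 (C2pow n) ->
  {in G, forall x, x ^+ 4 = 1} /\
  {in G &, forall x y, x ^ y = x \/ x ^ y = x^-1}.
Proof.
have [exp4 conjQ] := quaternion_exp4_dedekind (isog_refl 'Q_8).
have [_ abC expC] := and3P (C2pow_abelem n).
case/isogP=> f injf fG.
have expP e : e \in C2pow n -> e * e = 1 by apply: (exponentP expC).
have fP u : u \in G -> exists q, exists2 e, e \in C2pow n & f u = (q, e).
  move=> Gu; have := mem_morphim f Gu Gu; rewrite fG inE.
  by case: (f u) => q e /andP[_ Ce]; exists q, e.
split=> [u Gu | u v Gu Gv].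
  apply: (injmP injf); rewrite ?groupX // morph1 morphX //.
  have [q [e Ce ->]] := fP u Gu; have ee := expP e Ce.
  have eqe : (q, e) ^+ 4 = (q ^+ 4, e * e * (e * e)) by rewrite !expgS !mulg1 !mulgA.
  by rewrite eqe ee mulg1 exp4 ?inE.
have [q [e Ce fu]] := fP u Gu; have [r [d Cd fv]] := fP v Gv.
have ed : e ^ d = e by rewrite conjgE (centsP abC e Ce d Cd) mulKg.
have eV : e^-1 = e by apply/eqP; rewrite eq_invg_mul expP.
have fuv : f (u ^ v) = (q ^ r, e ^ d) by rewrite morphJ // fu fv.
have [] := conjQ q r; rewrite ?inE // => qr; [left | right];
  apply: (injmP injf); rewrite ?groupJ ?groupV // fuv ed qr ?morphV // fu //.
by rewrite -{1}eV.
Qed.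

Theorem theorem2p13 (gT : finGroupType) (G : {group gT})
    (G2 : 2.-group G) (nabG : ~~ abelian G) :
  cayley_integral G <->
  exists n : nat, G \isog setX 'Q_8 (C2pow n).
Proof.
split=> [Gint | [n isoG]].
  have G4 := cayley_integral_exp4 Gint G2.
  apply: (isog_quaternion_prod_C2pow G2 nabG G4).
    exact: (cayley_integral_involution_central Gint G4).
  exact: (cayley_integral_noncommuting Gint G4).
have [G4 conjG] := quaternion_prod_exp4_dedekind isoG.
exact: cayley_integral_exp4_dedekind.
Qed.
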